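(* Let $\mathcal G$, $\mathcal L$, the observation model and the notation be as in the context. Then there exists a constant $K_2>0$ such that $$\liminf_{n\to\infty}\;\inf_{\widehat g\in\mathcal L}\;\sup_{g\in\mathcal G}\;\mathbb P\left(\int_{X_g(\delta)}^{X_g(1-\delta)}|\widehat g(u)-g(u)|^2\,du>K_2\,n^{-2p/(2p+3)}\right)>0,$$ where the infimum is over all estimators $\widehat g$ of $g$ based on the $n$ observations that take values in $\mathcal L$.
   Context: $p\ge3$ is an integer, $\delta\in(0,1/2)$ is fixed, $D$ is an open interval containing $X_g([0,1])$ for every $g\in\mathcal G$, where $X_g$ is the solution of $X'(t)=g(X(t))$, $t\in[0,1]$, $X(0)=x_0$. With constants $0<c_0<c_1<\infty$ and $0<c_2<\infty$, $$\mathcal G=\{g:D\to\mathbb R_+:\ c_0\le g\le c_1,\ |g'|\le c_2,\ g\in C^p(D)\}.$$ With a constant $c_4\in(0,\infty)$, $c_4\ge c_2$, $$\mathcal L=\{h:D\to\mathbb R:\ |h(x)-h(y)|\le c_4|x-y|\ \text{for all }x,y\in D\}.$$ Observations: $Y_j=X_g(T_j)+\varepsilon_j$, $j=1,\dots,n$, where $\varepsilon_j$ are i.i.d. $N(0,\sigma_\varepsilon^2)$ with $\sigma_\varepsilon^2>0$, independent of the $T_j$, which are i.i.d. on $[0,1]$ with density $f_T$ satisfying $\underline c'\le f_T\le\overline c'$ for some $0<\underline c'\le\overline c'<\infty$. *)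

(* Defs.v *)
From HB Require Import structures.
From mathcomp Require Import all_boot all_order all_algebra.
From mathcomp Require Import all_classical all_reals all_analysis.

Set Implicit Arguments.
Unset Strict Implicit.
Unset Printing Implicit Defensive.

Import Order.TTheory GRing.Theory Num.Theory.
Import numFieldNormedType.Exports.

Local Open Scope classical_set_scope.
Local Open Scope ring_scope.

(* Functions on D are represented by total functions R -> R of which only the
   restriction to D matters.  Since D is open in all uses, the iterated
   derivatives at points of D depend only on that restriction. *)

Definition Cn_on (R : realType) (D : set R) (p : nat) (g : R -> R) : Prop :=
  (forall k, (k < p)%N -> forall x, D x -> derivable (derive1n k g) x 1) /\
  (forall x, D x -> {for x, continuous (derive1n p g)}).

Definition class_G (R : realType) (D : set R) (p : nat) (c0 c1 c2 : R) :
    set (R -> R) :=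
  [set g | [/\ forall x, D x -> c0 <= g x <= c1,
               forall x, D x -> `|derive1 g x| <= c2
             & Cn_on D p g]].

Definition class_L (R : realType) (D : set R) (c4 : R) : set (R -> R) :=
  [set h | c4.-lipschitz_D h].

(* X' = g(X) on [0, 1] with X(0) = x0; the derivative at t is taken within
   [0, 1], hence is one-sided at the end points. *)
Definition ode_solution (R : realType) (g : R -> R) (x0 : R) (X : R -> R) :
    Prop :=
  X 0 = x0 /\
  forall t : R, t \in `[0, 1] ->
    (fun s => (X s - X t) / (s - t)) @ within [set` `[0, 1]] t^' --> g (X t).

Definition mutually_independent (R : realType) (d : measure_display)
    (Omega : measurableType d) (P : probability Omega R) (I : eqType)
    (Z : I -> {RV P >-> R}) : Prop :=
  forall (J : seq I) (A : I -> set R), uniq J ->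
    (forall i, i \in J -> measurable (A i)) ->
    P (\big[setI/setT]_(i <- J) (Z i @^-1` A i)) =
    (\prod_(i <- J) P (Z i @^-1` A i))%E.

(* Z takes values in [0, 1] and has density f there. *)
Definition has_density01 (R : realType) (d : measure_display)
    (Omega : measurableType d) (P : probability Omega R)
    (Z : {RV P >-> R}) (f : R -> R) : Prop :=
  (forall w, Z w \in `[0, 1]) /\
  forall A : set R, measurable A ->
    distribution P Z A =
    (\int[lebesgue_measure]_(t in A `&` `[0%R, 1%R]) (f t)%:E)%E.

Definition sample (R : realType) (Omega : Type) (T eps : nat -> Omega -> R)
    (X : R -> R) (n : nat) (w : Omega) : n.-tuple (R * R) :=
  [tuple (T j w, X (T j w) + eps j w) | j < n].

(* Estimators based on (T_1, Y_1), ..., (T_n, Y_n) with values in L: evaluation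
   at each point of D is a measurable function of the data.  As the values are
   Lipschitz on D, this makes integrals over subintervals of D measurable. *)
Definition estimators (R : realType) (D : set R) (c4 : R) (n : nat) :
    set (n.-tuple (R * R) -> R -> R) :=
  [set ghat | (forall y, class_L D c4 (ghat y)) /\
     forall u, D u -> measurable_fun setT (fun y => ghat y u)].

Arguments estimators {R} D c4 n.

(* Main.v *)
(* The class G bounds g and g' but no derivative of order p, so a two-point
   argument suffices.  Take m = (c0 + c1) / 2 and compare g0 = m with
     g1 = 1 / (1 / m + k h cos (x / h)),   h = n^(-1/4),
   for a small constant k.  The time to reach a position, the primitive of
   1 / g1, is (x - x0) / m + k h^2 (sin (x / h) - sin (x0 / h)), so the two
   solutions differ by at most 2 m k h^2 on [0, 1], whereas the squared L^2
   distance between g0 and g1 on a fixed interval is at least of order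
   h^2 = n^(-1/2) >= n^(-2p/(2p+3)).  As n h^4 = 1, the second moment of the
   likelihood ratio of the two samples stays bounded, and Cauchy-Schwarz
   transfers an event of probability at least 1/2 under g1 to an event of
   probability bounded below under g0.  The bound on the second moment is kept
   in the form (int f d mu1)^2 <= C int f^2 d mu0 for all f >= 0, which
   tensorizes by Tonelli's theorem. *)

From HB Require Import structures.
Require Import Defs.
From mathcomp Require Import all_boot all_order all_algebra.
From mathcomp Require Import all_classical all_reals all_analysis.
From mathcomp Require Import measurable_realfun ring lra.

Set Implicit Arguments.
Unset Strict Implicit.
Unset Printing Implicit Defensive.

Import Order.TTheory GRing.Theory Num.Theory.
Import numFieldNormedType.Exports.

Local Open Scope classical_set_scope.
Local Open Scope ring_scope.

(** * Cauchy-Schwarz inequality for extended-valued functions *)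

(** The choice s = B / (2x) turns the hypothesis into x <= (AB/x + x) / 2. Unlike the minimiser over
    s, it involves no square root and no division by A, which may be 0. *)
Lemma sqr_le_mul_of_young {R : realType} (x A B : R) :
  0 <= x -> 0 <= A -> 0 < B ->
  (forall s, 0 < s -> x <= s * A + B / (4 * s)) -> x ^+ 2 <= A * B.
Proof.
move=> x0 A0 B0 H; have [->|xn0] := eqVneq x 0.
  by rewrite expr0n /= mulr_ge0// ltW.
have xp : 0 < x by rewrite lt_def xn0.
have := H (B / (2 * x)); rewrite divr_gt0 ?mulr_gt0// => /(_ isT).
have -> : B / (2 * x) * A + B / (4 * (B / (2 * x))) = (A * B / x + x) / 2.
  by field; rewrite !gt_eqF//= mulr_gt0.
rewrite -(ler_pM2r xp).
have -> : (A * B / x + x) / 2 * x = (A * B + x ^+ 2) / 2 by field.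
lra.
Qed.

Lemma emeasurable_sqr d (T : measurableType d) (R : realType) (f : T -> \bar R) :
  measurable_fun setT f -> measurable_fun setT (fun x => f x ^+ 2)%E.
Proof. by move=> mf; under eq_fun do rewrite expe2; exact: emeasurable_funM. Qed.

Lemma sqre_ge0 (R : realType) (x : \bar R) : (0 <= x -> 0 <= x ^+ 2)%E.
Proof. by move=> x0; rewrite expe2 mule_ge0. Qed.

Section cauchy_schwarz.
Local Open Scope ereal_scope.
Context d (T : measurableType d) (R : realType).
Variable mu : {measure set T -> \bar R}.

(** Young's inequality f g <= s f^2 + g^2 / (4s) is integrated and then optimised over s. If f^2 has
    infinite integral the right side is infinite, as B > 0. *)
Lemma ge0_cauchy_schwarz (f : T -> \bar R) (g : T -> R) (B : R) :
  measurable_fun setT f -> (forall x, 0 <= f x) ->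
  measurable_fun setT g -> (forall x, (0 <= g x)%R) ->
  (0 < B)%R -> \int[mu]_x ((g x) ^+ 2)%:E = B%:E ->
  (\int[mu]_x (f x * (g x)%:E)) ^+ 2 <= \int[mu]_x (f x ^+ 2) * B%:E.
Proof.
move=> mf f0 mg g0 B0 gB.
have mf2 : measurable_fun setT (fun x => f x ^+ 2).
  exact: emeasurable_sqr.
have f20 x : 0 <= f x ^+ 2 by rewrite expe2 mule_ge0.
have I0 : 0 <= \int[mu]_x (f x * (g x)%:E).
  by apply: integral_ge0 => x _; rewrite mule_ge0// lee_fin.
have A0 : 0 <= \int[mu]_x (f x ^+ 2) by exact: integral_ge0.
have [Aoo|Afin] := eqVneq (\int[mu]_x (f x ^+ 2)) +oo.
  by rewrite Aoo gt0_mulye ?lte_fin// leey.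
have mfg : measurable_fun setT (fun x => f x * (g x)%:E).
  by apply: emeasurable_funM => //; exact/measurable_EFinP.
have Y (s : R) : (0 < s)%R ->
    \int[mu]_x (f x * (g x)%:E) <= s%:E * \int[mu]_x (f x ^+ 2) + (B / (4 * s))%:E.
  move=> s0.
  have c0 : (0 <= (4 * s)^-1)%R by rewrite invr_ge0 mulr_ge0// ltW.
  have mg2 : measurable_fun setT (fun x => ((g x) ^+ 2)%:E).
    by apply/measurable_EFinP; exact: measurable_funX.
  have -> : (B / (4 * s))%:E = \int[mu]_x (((4 * s)^-1)%:E * ((g x) ^+ 2)%:E).
    rewrite ge0_integralZl//; last by move=> x _; rewrite lee_fin sqr_ge0.
    by rewrite gB -EFinM mulrC.
  have -> : s%:E * \int[mu]_x (f x ^+ 2) = \int[mu]_x (s%:E * f x ^+ 2).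
    by rewrite ge0_integralZl// lee_fin ltW.
  rewrite -ge0_integralD//; last 4 first.
  - by move=> x _; rewrite mule_ge0// lee_fin ltW.
  - exact: measurable_funeM.
  - by move=> x _; rewrite mule_ge0// lee_fin// sqr_ge0.
  - exact: measurable_funeM.
  apply: ge0_le_integral => //.
  - by move=> x _; rewrite mule_ge0// lee_fin.
  - by apply: emeasurable_funD; exact: measurable_funeM.
  move=> x _; move: (f0 x); case: (f x) => [r| |] // r0.
    rewrite expe2 -!EFinM -EFinD lee_fin -subr_ge0.
    (* Young's inequality by completing the square. *)
    rewrite [leRHS](_ : _ = s * (r - g x / (2 * s)) ^+ 2)%R.
      by rewrite mulr_ge0 ?sqr_ge0 ?ltW.
    by field; rewrite gt_eqF.
  by rewrite expe2 mulyy gt0_muley ?lte_fin// addye ?leey// -EFinM.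
have Ifin : \int[mu]_x (f x * (g x)%:E) \is a fin_num.
  rewrite ge0_fin_numE//; apply: le_lt_trans (Y 1%R ltr01) _.
  by rewrite mul1e lte_add_pinfty ?ltry// lt_neqAle Afin leey.
have Afn : \int[mu]_x (f x ^+ 2) \is a fin_num.
  by rewrite ge0_fin_numE// lt_neqAle Afin leey.
move: Y I0 A0; rewrite -(fineK Ifin) -(fineK Afn) expe2 -!EFinM !lee_fin => Y I0 A0.
rewrite -expr2; exact: sqr_le_mul_of_young.
Qed.

End cauchy_schwarz.

(** * Integration against a measure with a density *)

Section density.
Local Open Scope ereal_scope.
Context d (T : measurableType d) (R : realType).
Variables (mu nu : {measure set T -> \bar R}) (h : T -> R).
Hypotheses (mh : measurable_fun setT h) (h0 : forall x, (0 <= h x)%R).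
Hypothesis nuE : forall A, measurable A -> nu A = \int[mu]_(x in A) (h x)%:E.

Import HBNNSimple.

Let mEh : measurable_fun setT (EFin \o h).
Proof. exact/measurable_EFinP. Qed.

Let density_nnsfun (f : {nnsfun T >-> R}) :
  \int[nu]_x (f x)%:E = \int[mu]_x ((f x)%:E * (h x)%:E).
Proof.
under [LHS]eq_integral do rewrite fimfunE -fsumEFin//.
rewrite [LHS]ge0_integral_fsum//; last 2 first.
  - by move=> r; exact/measurable_EFinP/measurableT_comp.
  - by move=> n x _; rewrite EFinM nnfun_muleindic_ge0.
under [RHS]eq_integral.
  move=> x xD; rewrite fimfunE -fsumEFin// ge0_mule_fsuml; last first.
    by move=> r; rewrite EFinM nnfun_muleindic_ge0.
  over.
rewrite [RHS]ge0_integral_fsum//; last 2 first.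
  - move=> r; apply: emeasurable_funM => //.
    by apply/measurable_EFinP; do 2 apply/measurableT_comp => //.
  - move=> n x _; rewrite mule_ge0//; last by rewrite lee_fin.
    by rewrite EFinM nnfun_muleindic_ge0.
apply: eq_fsbigr => r _; rewrite integralZl_indic_nnsfun//= integral_indic// setIT.
rewrite nuE//.
(* The sum over values r runs over all reals; a negative r has empty preimage and contributes 0 on
   both sides. *)
have [r0|r0] := leP 0%R r; last first.
  rewrite preimage_nnfun0// !integral_set0 mule0.
  under eq_integral do rewrite indic0 mulr0 mul0e.
  by rewrite integral0.
under [RHS]eq_integral do rewrite EFinM -muleA.
rewrite ge0_integralZl ?lee_fin//; last 2 first.
  - apply: emeasurable_funM => //; exact/measurable_EFinP.
  - by move=> x _; rewrite mule_ge0 ?lee_fin.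
congr (_ * _); rewrite integral_mkcond; apply: eq_integral => x _.
by rewrite patchE indicE; case: ifPn; rewrite ?mul1e ?mul0e.
Qed.

(** Simple functions reduce to [nuE] on their level sets; monotone convergence extends the identity
    to all nonnegative f. *)
Lemma ge0_integral_density (f : T -> \bar R) :
  measurable_fun setT f -> (forall x, 0 <= f x) ->
  \int[nu]_x f x = \int[mu]_x (f x * (h x)%:E).
Proof.
move=> mf f0; pose g := nnsfun_approx measurableT mf.
have gf x : EFin \o g ^~ x @ \oo --> f x by exact: cvg_nnsfun_approx.
transitivity (limn (fun n => \int[nu]_x (g n x)%:E)).
  rewrite -monotone_convergence//.
  - by apply: eq_integral => x _; apply/esym/cvg_lim => //; exact: gf.
  - by move=> n; exact/measurable_EFinP.
  - by move=> n x _; rewrite lee_fin.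
  - by move=> x _ a b ab; rewrite lee_fin; exact/lefP/nd_nnsfun_approx.
under eq_fun do rewrite density_nnsfun.
rewrite -monotone_convergence//.
- apply: eq_integral => x _; apply/cvg_lim => //.
  by apply: cvgeZr => //; exact: gf.
- by move=> n; apply: emeasurable_funM => //; exact/measurable_EFinP.
- by move=> n x _; rewrite mule_ge0 ?lee_fin.
- move=> x _ a b ab; rewrite lee_wpmul2r ?lee_fin//.
  exact/lefP/nd_nnsfun_approx.
Qed.

End density.

(** * Second moment of the likelihood ratio of shifted Gaussians *)

Section gaussian_shift.
Local Open Scope ereal_scope.
Context {R : realType}.
Notation mu := (@lebesgue_measure R).

Lemma lebesgue_measure_shift (c : R) (A : set R) : measurable A ->
  pushforward mu (fun x : R => x + c : measurableTypeR R)%R A = mu A.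
Proof.
move=> mA; apply/esym/lebesgue_measure_unique => //= [|_ _ [[a b] _ <-]].
  exact: (@measurable_funD _ R R).
rewrite /pushforward /= (_ : _ @^-1` _ = `](a - c)%R, (b - c)%R]%classic).
  rewrite !lebesgue_measure_itv/= !lte_fin ltrD2r; case: ifP => // _.
  by rewrite -!EFinB; congr EFin; ring.
by apply/seteqP; split => x /=; rewrite !in_itv/= ltrBlDr lerBrDr.
Qed.

Lemma ge0_integral_shift (c : R) (f : R -> \bar R) :
  measurable_fun setT f -> (forall x, 0 <= f x) ->
  \int[mu]_x f (x + c)%R = \int[mu]_x f x.
Proof.
move=> mf f0.
have mc : measurable_fun setT (fun x : R => x + c : measurableTypeR R)%R.
  exact: measurable_funD.
transitivity (\int[pushforward mu (fun x : R => x + c : measurableTypeR R)%R]_x f x).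
  by rewrite ge0_integral_pushforward.
by apply: eq_measure_integral => A mA _; exact: lebesgue_measure_shift.
Qed.

Lemma normal_pdf_shift (s x c : R) : (s != 0)%R ->
  (normal_pdf 0 s (x + c) = expR (- (x * c / s ^+ 2) - c ^+ 2 / (s ^+ 2 *+ 2)) *
   normal_pdf 0 s x)%R.
Proof.
move=> s0; rewrite normal_pdfE//= mulrCA; congr (_ * _)%R.
rewrite /normal_fun -expRD; congr expR.
by field.
Qed.

Lemma ge0_integral_normal_prob (s : R) (f : R -> \bar R) :
  measurable_fun setT f -> (forall x, 0 <= f x) ->
  \int[normal_prob 0 s]_x f x = \int[mu]_x (f x * (normal_pdf 0 s x)%:E).
Proof.
move=> mf f0; apply: ge0_integral_density.
- exact: measurable_normal_pdf.
- exact: normal_pdf_ge0.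
- by move=> A mA; rewrite /normal_prob.
- exact: mf.
- exact: f0.
Qed.

(** This is the bound for a single observation. A translation rewrites the left integral as that of
    f (b + e) times a likelihood ratio q, and Cauchy-Schwarz leaves the second moment of q, which
    equals exp ((a - b)^2 / s^2). *)
Lemma gaussian_shift (s a b : R) (f : R -> \bar R) : (s != 0)%R ->
  measurable_fun setT f -> (forall x, 0 <= f x) ->
  (\int[normal_prob 0 s]_e f (a + e)%R) ^+ 2 <=
  (expR ((a - b) ^+ 2 / s ^+ 2))%:E * \int[normal_prob 0 s]_e (f (b + e)%R ^+ 2).
Proof.
move=> s0 mf f0.
have mfs (c : R) : measurable_fun setT (fun e => f (c + e)%R).
  by apply: measurableT_comp => //; exact: measurable_funD.
have np := @normal_pdf_ge0 R 0 s.
have mnp := @measurable_normal_pdf R 0 s.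
rewrite (ge0_integral_normal_prob s (mfs a) (fun=> f0 _)).
pose c := (b - a)%R.
have -> : \int[mu]_x (f (a + x)%R * (normal_pdf 0 s x)%:E) =
          \int[mu]_x (f (b + x)%R * (normal_pdf 0 s (x + c))%:E).
  rewrite -[LHS](ge0_integral_shift c); last 2 first.
  - by apply: emeasurable_funM => //; exact/measurable_EFinP.
  - by move=> x; rewrite mule_ge0// lee_fin.
  by apply: eq_integral => x _; congr (f _ * _); rewrite /c; ring.
(* q is the density of N(-c, s^2) with respect to N(0, s^2). *)
pose q x := expR (- (x * c / s ^+ 2) - c ^+ 2 / (s ^+ 2 *+ 2)).
have mq : measurable_fun setT q.
  apply: measurableT_comp => //; apply: measurable_funB => //.
  apply: measurableT_comp => //; apply: measurable_funM => //.
  exact: measurable_funM.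
have -> : \int[mu]_x (f (b + x)%R * (normal_pdf 0 s (x + c))%:E) =
          \int[normal_prob 0 s]_x (f (b + x)%R * (q x)%:E).
  rewrite [RHS]ge0_integral_normal_prob.
  - by apply: eq_integral => x _; rewrite normal_pdf_shift// EFinM muleA.
  - by apply: emeasurable_funM => //; exact/measurable_EFinP.
  - by move=> x; rewrite mule_ge0// lee_fin expR_ge0.
rewrite muleC; apply: ge0_cauchy_schwarz.
- exact: mfs.
- by move=> x; exact: f0.
- exact: mq.
- by move=> x; exact: expR_ge0.
- exact: expR_gt0.
rewrite ge0_integral_normal_prob; last 2 first.
- by apply/measurable_EFinP; exact: measurable_funX.
- by move=> x; rewrite lee_fin sqr_ge0.
(* Completing the square: q^2 times the density is a constant multiple of the density translated by
   2c, so its integral is that constant. *)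
have E x : ((q x) ^+ 2)%:E * (normal_pdf 0 s x)%:E =
    (expR ((a - b) ^+ 2 / s ^+ 2))%:E * (normal_pdf 0 s (x + 2 * c))%:E.
  rewrite -!EFinM normal_pdf_shift//; congr EFin.
  rewrite [RHS]mulrA; congr (_ * _)%R; rewrite /q -expRD -expRM_natl; congr expR.
  by rewrite /c; field.
under eq_integral do rewrite E.
rewrite ge0_integralZl ?lee_fin ?expR_ge0//; last 2 first.
- by apply/measurable_EFinP/measurableT_comp => //; exact: measurable_funD.
- by move=> x _; rewrite lee_fin.
rewrite (@ge0_integral_shift (2 * c)%R (fun x => (normal_pdf 0 s x)%:E))//.
- by rewrite integral_normal_pdf mule1.
- exact/measurable_EFinP.
Qed.

End gaussian_shift.

(** * Change of measure for product laws *)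

Section tuple_prob.
Local Open Scope ereal_scope.
Context d (S : measurableType d) (R : realType).

Definition cons_pair n (z : S * n.-tuple S) : n.+1.-tuple S :=
  [the n.+1.-tuple S of z.1 :: z.2].

Lemma measurable_cons_pair n : measurable_fun setT (@cons_pair n).
Proof. exact: measurable_cons. Qed.

HB.instance Definition _ n := isMeasurableFun.Build _ _ _ _ (@cons_pair n)
  (@measurable_cons_pair n).

(** The n-fold product law, built by adding one coordinate at the head so that Tonelli's theorem can
    split it off in inductions. *)
Fixpoint tuple_prob (nu : probability S R) n : probability (n.-tuple S) R :=
  if n is m.+1 then distribution (nu \x tuple_prob nu m) (@cons_pair m)
  else \d_([tuple] : 0.-tuple S).

Lemma ge0_integral_tuple_probS (nu : probability S R) n (f : n.+1.-tuple S -> \bar R) :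
  measurable_fun setT f -> (forall t, 0 <= f t) ->
  \int[tuple_prob nu n.+1]_t f t =
  \int[nu]_z \int[tuple_prob nu n]_t f (cons_pair (z, t)).
Proof.
move=> mf f0; rewrite /= ge0_integral_distribution// fubini_tonelli1//=.
by apply: measurableT_comp => //; exact: measurable_cons_pair.
Qed.

Lemma tuple_prob_rect (nu : probability S R) n (M : 'I_n -> set S) :
  (forall i, measurable (M i)) ->
  tuple_prob nu n [set t | forall i, M i (tnth t i)] = \prod_(i < n) nu (M i).
Proof.
elim: n M => [|n IHn] M mM.
  by rewrite big_ord0 /= diracE mem_set// => -[].
rewrite big_ord_recl -IHn// /= /distribution /pushforward.
rewrite (_ : _ @^-1` _ =
  M ord0 `*` [set t | forall i, M (lift ord0 i) (tnth t i)]); last first.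
  apply/seteqP; split => [[z t]/= H|[z t]/= [H0 H] i].
    split; first by have := H ord0; rewrite (tnth_nth z).
    by move=> i; have := H (lift ord0 i); rewrite !(tnth_nth z).
  case: (unliftP ord0 i) => [j ->|->]; last by rewrite (tnth_nth z).
  by have := H j; rewrite !(tnth_nth z).
rewrite product_measure1E//.
rewrite (_ : [set t | _] = \bigcap_(i in [set: 'I_n]) (@tnth _ S ^~ i) @^-1` M (lift ord0 i)).
  apply: fin_bigcap_measurable => // i _.
  by rewrite -[X in measurable X]setTI; exact: measurable_tnth.
by apply/seteqP; split => t /= H i; [move=> _|]; exact: H.
Qed.

End tuple_prob.

Section tensorization.
Local Open Scope ereal_scope.
Context d d' (S : measurableType d) (S' : measurableType d') (R : realType).
Variables (nu : probability S R) (phi0 phi1 : S -> S') (C : R).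
Hypotheses (mphi0 : measurable_fun setT phi0) (mphi1 : measurable_fun setT phi1).
Hypothesis C0 : (0 <= C)%R.
Hypothesis chi2 : forall f : S' -> \bar R,
  measurable_fun setT f -> (forall x, 0 <= f x) ->
  (\int[nu]_z f (phi1 z)) ^+ 2 <= C%:E * \int[nu]_z (f (phi0 z) ^+ 2).

Lemma measurable_map_tuple n (phi : S -> S') : measurable_fun setT phi ->
  measurable_fun setT (fun t : n.-tuple S => [tuple of map phi t]).
Proof.
move=> mphi; apply/measurable_fun_tnthP => i.
rewrite (_ : _ \o _ = phi \o (@tnth _ S ^~ i)).
  by apply: measurableT_comp => //; exact: measurable_tnth.
by apply/funext => t /=; rewrite tnth_map.
Qed.

Lemma map_cons_pair n (phi : S -> S') z (t : n.-tuple S) :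
  [tuple of map phi (cons_pair (z, t))] = cons_pair (phi z, [tuple of map phi t]).
Proof. exact: val_inj. Qed.

(** Induction on n: [chi2] is applied to the head coordinate after the tail has been integrated out,
    and the induction hypothesis then bounds the squared tail integral for each fixed head. *)
Lemma chi2_tensorization n (f : n.-tuple S' -> \bar R) :
  measurable_fun setT f -> (forall x, 0 <= f x) ->
  (\int[tuple_prob nu n]_t f [tuple of map phi1 t]) ^+ 2 <=
  (C ^+ n)%:E * \int[tuple_prob nu n]_t (f [tuple of map phi0 t] ^+ 2).
Proof.
elim: n f => [|n IHn] f mf f0.
  rewrite /= !integral_dirac// ?diracT ?expr0 ?mul1e.
  - by rewrite (tuple0 [tuple of map phi1 _]) (tuple0 [tuple of map phi0 _]).
  - by apply: emeasurable_sqr; apply: measurableT_comp => //; exact: measurable_map_tuple.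
  - by apply: measurableT_comp => //; exact: measurable_map_tuple.
have mfm (phi : S -> S') m (g : m.-tuple S' -> \bar R) : measurable_fun setT phi ->
    measurable_fun setT g ->
    measurable_fun setT (fun t : m.-tuple S => g [tuple of map phi t]).
  by move=> mphi mg; apply: measurableT_comp => //; exact: measurable_map_tuple.
rewrite !ge0_integral_tuple_probS//; last 3 first.
- by apply: emeasurable_sqr; exact: (mfm phi0 n.+1 f mphi0 mf).
- by move=> t; exact: sqre_ge0.
- exact: (mfm phi1 n.+1 f mphi1 mf).
(* The tail integral g can be infinite, hence the extended-valued functions in [chi2]. *)
pose g s := \int[tuple_prob nu n]_t f (cons_pair (s, [tuple of map phi1 t])).
have mcp phi : measurable_fun setT phi ->
    measurable_fun setT (fun z : S' * n.-tuple S => f (cons_pair (z.1, [tuple of map phi z.2]))).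
  move=> mphi; apply: measurableT_comp => //.
  apply: (measurableT_comp (@measurable_cons_pair _ S' n)).
  apply: measurable_fun_pair => //=.
  apply: (@measurableT_comp _ _ _ _ _ _ (fun t : n.-tuple S => [tuple of map phi t])) => //.
  exact: measurable_map_tuple.
have mg : measurable_fun setT g.
  by apply: (measurable_fun_fubini_tonelli_F (fun z : S' * n.-tuple S =>
    f (cons_pair (z.1, [tuple of map phi1 z.2])))) => //; exact: mcp.
have g0 s : 0 <= g s by exact: integral_ge0.
have -> : \int[nu]_z \int[tuple_prob nu n]_t f [tuple of map phi1 (cons_pair (z, t))] =
          \int[nu]_z g (phi1 z).
  by apply: eq_integral => z _; apply: eq_integral => t _; rewrite map_cons_pair.
apply: le_trans (chi2 mg g0) _.
rewrite exprS EFinM -muleA; apply: lee_wpmul2l; first by rewrite lee_fin.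
(* G is the counterpart of g on the other side: f^2 with its tail under [phi0]. It remains to
   compare g^2 with C^n G at [phi0 z]. *)
pose G s := \int[tuple_prob nu n]_t (f (cons_pair (s, [tuple of map phi0 t])) ^+ 2).
have mG : measurable_fun setT G.
  apply: (measurable_fun_fubini_tonelli_F (fun z : S' * n.-tuple S =>
    f (cons_pair (z.1, [tuple of map phi0 z.2])) ^+ 2)).
    by apply: emeasurable_sqr; exact: mcp.
  by move=> z; exact: sqre_ge0.
have G0 s : 0 <= G s by apply: integral_ge0 => t _; exact: sqre_ge0.
have -> : \int[nu]_z \int[tuple_prob nu n]_t
    (f [tuple of map phi0 (cons_pair (z, t))] ^+ 2) = \int[nu]_z G (phi0 z).
  by apply: eq_integral => z _; apply: eq_integral => t _; rewrite map_cons_pair.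
rewrite -ge0_integralZl//; last 2 first.
- exact: measurableT_comp.
- by rewrite lee_fin exprn_ge0.
apply: ge0_le_integral => //.
- by move=> z _; exact: sqre_ge0.
- by apply: emeasurable_sqr; exact: measurableT_comp.
- by apply: measurable_funeM; exact: measurableT_comp.
move=> z _; apply: (IHn (fun t => f (cons_pair (phi0 z, t)))) => //.
apply: measurableT_comp => //; apply: (measurableT_comp (@measurable_cons_pair _ S' n)).
exact: pair1_measurable.
Qed.

End tensorization.

(** * Uniqueness of laws on tuples of pairs *)

Section tuple_measure_unique.
Context d1 d2 (S1 : measurableType d1) (S2 : measurableType d2) (R : realType).

(** Both components of every pair are constrained separately, because mutual independence of design
    and noise determines the probability of exactly such boxes. *)
Definition tuple_rect n (A : 'I_n -> set S1) (B : 'I_n -> set S2) : set (n.-tuple (S1 * S2)) :=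
  [set t | forall i, A i (tnth t i).1 /\ B i (tnth t i).2].

Definition tuple_rects n : set (set (n.-tuple (S1 * S2))) :=
  [set E | exists A B, [/\ forall i, measurable (A i), forall i, measurable (B i)
     & E = tuple_rect A B]].

Lemma tuple_rect_measurable n (A : 'I_n -> set S1) (B : 'I_n -> set S2) :
  (forall i, measurable (A i)) -> (forall i, measurable (B i)) ->
  measurable (tuple_rect A B).
Proof.
move=> mA mB.
rewrite (_ : tuple_rect A B = \bigcap_(i in [set: 'I_n])
   (@tnth _ (S1 * S2)%type ^~ i) @^-1` (A i `*` B i)).
  apply: fin_bigcap_measurable => // i _.
  rewrite -[X in measurable X]setTI; apply: measurable_tnth => //.
  exact: measurableX.
by apply/seteqP; split => t /= H i; [move=> _|]; exact: H.
Qed.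

(** For the sigma-algebra generated by the boxes, both components of each coordinate are measurable;
    hence so is the identity map into the tuple space. *)
Lemma tuple_rects_gen n :
  @measurable _ (n.-tuple (S1 * S2)%type) = <<s @tuple_rects n >>.
Proof.
apply/seteqP; split; last first.
  apply: smallest_sub; first exact: sigma_algebra_measurable.
  by move=> _ [A [B [mA mB ->]]]; exact: tuple_rect_measurable.
pose G := g_sigma_algebraType (@tuple_rects n).
have mfst (i : 'I_n) : measurable_fun setT (fun t : G => (tnth (t : n.-tuple (S1 * S2)) i).1).
  move=> _ M mM; rewrite setTI; apply: sub_sigma_algebra.
  exists (fun j => if j == i then M else setT), (fun=> setT); split => //.
    by move=> j; case: ifP.
  apply/seteqP; split => t /= H.
    by move=> j; split => //; case: eqP => [->|].
  by have [] := H i; rewrite eqxx.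
have msnd (i : 'I_n) : measurable_fun setT (fun t : G => (tnth (t : n.-tuple (S1 * S2)) i).2).
  move=> _ M mM; rewrite setTI; apply: sub_sigma_algebra.
  exists (fun=> setT), (fun j => if j == i then M else setT); split => //.
    by move=> j; case: ifP.
  apply/seteqP; split => t /= H.
    by move=> j; split => //; case: eqP => [->|].
  by have [_] := H i; rewrite eqxx.
have mid : measurable_fun setT (fun t : G => t : n.-tuple (S1 * S2)).
  apply/measurable_fun_tnthP => i; apply/measurable_fun_pairP; split.
    exact: mfst.
  exact: msnd.
by move=> E mE; have := mid measurableT E mE; rewrite setTI.
Qed.

(** The boxes form a generating family stable under intersection and containing the whole space. *)
Lemma tuple_prob_unique n (m1 m2 : probability (n.-tuple (S1 * S2)) R) :
  (forall A B, (forall i, measurable (A i)) -> (forall i, measurable (B i)) ->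
     m1 (tuple_rect A B) = m2 (tuple_rect A B)) ->
  forall E, measurable E -> m1 E = m2 E.
Proof.
move=> H E mE; apply: (measure_unique (@tuple_rects n) (fun=> setT)) => //.
- exact: tuple_rects_gen.
- move=> _ _ [A [B [mA mB ->]]] [A' [B' [mA' mB' ->]]].
  exists (fun i => A i `&` A' i), (fun i => B i `&` B' i); split.
  + by move=> i; exact: measurableI.
  + by move=> i; exact: measurableI.
  apply/seteqP; split => [t [H1 H2] i|t H1] /=.
    by have [? ?] := H1 i; have [? ?] := H2 i.
  by split => i; have [[? ?] [? ?]] := H1 i.
- move=> _; exists (fun=> setT), (fun=> setT); split => //.
  by apply/seteqP; split.
- by rewrite bigcup_const//; exists 0%N.
- by move=> _ [A [B [mA mB ->]]]; exact: H.
- by move=> k; apply: le_lt_trans (probability_le1 _ _) _ => //; rewrite ltry.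
Qed.

End tuple_measure_unique.

(** * Law of the sample *)

(* [normal_prob] is a measure on [measurableTypeR R], whose display is not the
   one of the default measurable structure of [R]. *)
Definition regression_pair {R : realType} (x : R -> R) (z : R * measurableTypeR R) : R * R :=
  (z.1, x z.1 + z.2).

Lemma measurable_regression_pair {R : realType} (x : R -> R) :
  measurable_fun setT x -> measurable_fun setT (regression_pair x).
Proof.
move=> mx; apply: measurable_fun_pair => //=.
by apply: measurable_funD => //; exact: measurableT_comp.
Qed.

Section regression_chi2.
Local Open Scope ereal_scope.
Context {R : realType} (lam : probability R R) (s c : R) (x0 x1 : R -> R).
Hypotheses (s0 : (s != 0)%R).
Hypotheses (mx0 : measurable_fun setT x0) (mx1 : measurable_fun setT x1).
Hypothesis x01 : forall t, ((x1 t - x0 t) ^+ 2 / s ^+ 2 <= c)%R.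

(** Given the design point t, the two responses are Gaussian with means x1 t and x0 t, so
    [gaussian_shift] applies on each fibre with constant at most exp c. *)
Lemma regression_chi2 (f : R * R -> \bar R) :
  measurable_fun setT f -> (forall z, 0 <= f z) ->
  (\int[lam \x normal_prob 0 s]_z f (regression_pair x1 z)) ^+ 2 <=
  (expR c)%:E * \int[lam \x normal_prob 0 s]_z (f (regression_pair x0 z) ^+ 2).
Proof.
move=> mf f0.
have mfr (x : R -> R) : measurable_fun setT x ->
    measurable_fun setT (fun z => f (regression_pair x z)).
  by move=> mx; apply: measurableT_comp => //; exact: measurable_regression_pair.
have mfr2 (x : R -> R) : measurable_fun setT x ->
    measurable_fun setT (fun z => f (regression_pair x z) ^+ 2).
  by move=> mx; apply: emeasurable_sqr; exact: mfr.
have f20 x z : 0 <= f (regression_pair x z) ^+ 2 by exact: sqre_ge0.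
rewrite (fubini_tonelli1 _ (mfr _ mx1) (fun=> f0 _)).
rewrite (fubini_tonelli1 _ (mfr2 _ mx0) (f20 x0)).
set h := fubini_F _ _; set k := fubini_F _ _.
have mh : measurable_fun setT h by exact: (measurable_fun_fubini_tonelli_F _ (mfr _ mx1)).
have mk : measurable_fun setT k by exact: (measurable_fun_fubini_tonelli_F _ (mfr2 _ mx0)).
have h0 t : 0 <= h t by exact: integral_ge0.
have k0 t : 0 <= k t by exact: integral_ge0.
(* Cauchy-Schwarz against the constant 1 moves the square inside the integral over the design. *)
have one : \int[lam]_t ((cst 1%R t : R) ^+ 2)%:E = 1%:E.
  under eq_integral do rewrite expr1n.
  by rewrite integral_cst// mul1e; exact: probability_setT.
have := ge0_cauchy_schwarz mh h0 (measurable_cst _) (fun=> ler01) ltr01 one.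
under eq_integral do rewrite mule1.
rewrite mule1 => /le_trans; apply.
rewrite -ge0_integralZl ?lee_fin ?expR_ge0//.
apply: ge0_le_integral => //.
- by move=> t _; exact: sqre_ge0.
- exact: emeasurable_sqr.
- exact: measurable_funeM.
move=> t _.
have mft : measurable_fun setT (fun y => f (t, y)) by exact: measurableT_comp.
apply: le_trans (gaussian_shift (x1 t) (x0 t) s0 mft (fun=> f0 _)) _.
apply: lee_wpmul2r; first exact: k0.
by rewrite lee_fin ler_expR.
Qed.

End regression_chi2.

Section sample_law.
Local Open Scope ereal_scope.
Context {R : realType} d (Omega : measurableType d) (P : probability Omega R).
Variables (T eps : nat -> {RV P >-> R}).
Variables (lam : probability R R) (nu : probability (measurableTypeR R) R).
Hypothesis lamE : forall j (A : set R), measurable A -> distribution P (T j) A = lam A.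
Hypothesis nuE : forall j (A : set R), measurable A -> distribution P (eps j) A = nu A.
Hypothesis indep : mutually_independent
  (fun i : nat + nat => match i with inl j => T j | inr j => eps j end).

(** The randomness of a sample without its regression function: the samples under both hypotheses
    are images of this one vector. *)
Definition design_noise n (w : Omega) : n.-tuple (R * measurableTypeR R) :=
  [tuple (T j w, eps j w) | j < n].

Lemma measurable_design_noise n : measurable_fun setT (@design_noise n).
Proof.
apply/measurable_fun_tnthP => i.
rewrite (_ : _ \o _ = fun w => (T i w, eps i w)); last first.
  by apply/funext => w /=; rewrite tnth_mktuple.
apply: measurable_fun_pair; first exact: measurable_funP.
have mE : measurable_fun setT (eps i) by exact: measurable_funP.
exact: mE.
Qed.

HB.instance Definition _ n := isMeasurableFun.Build _ _ _ _ (@design_noise n)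
  (@measurable_design_noise n).

Lemma design_noise_law n E : measurable E ->
  P (@design_noise n @^-1` E) = tuple_prob (lam \x nu) n E.
Proof.
move=> mE; apply: (@tuple_prob_unique _ _ _ _ _ _ (distribution P (@design_noise n))) => //.
move=> A B mA mB; rewrite /tuple_rect.
rewrite [RHS](@tuple_prob_rect _ _ _ (lam \x nu) n (fun i => A i `*` B i)); last first.
  by move=> i; exact: measurableX.
(* Independence is indexed by all natural numbers, so a family over ['I_n] is extended by the whole
   line; J lists the first n design points and the first n errors. *)
pose ext (M : 'I_n -> set R) j := oapp M setT (insub j).
have extE M (i : 'I_n) : ext M i = M i by rewrite /ext valK.
pose D (i : nat + nat) := match i with inl j => ext A j | inr j => ext B j end.
have mD i : measurable (D i).
  by case: i => j; rewrite /D /ext; case: insubP => [u _ _|_] /=;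
    [exact: mA|exact: measurableT|exact: mB|exact: measurableT].
pose J := map inl (index_iota 0 n) ++ map inr (index_iota 0 n) : seq (nat + nat).
have uJ : uniq J.
  rewrite cat_uniq !map_inj_uniq ?iota_uniq ?andbT//=; last 2 first.
  - by move=> ? ? [].
  - by move=> ? ? [].
  by apply/hasPn => _ /mapP[j _ ->]; apply/mapP => -[].
have := indep uJ (fun i _ => mD i).
rewrite !big_cat/= !big_map !big_mkord => H.
under eq_bigr do rewrite product_measure1E//.
rewrite big_split/=; transitivity (
  (\prod_(i < n) P (T i @^-1` ext A i)) * \prod_(i < n) P (eps i @^-1` ext B i)).
  rewrite -H /distribution /pushforward; congr (P _).
  rewrite -!bigcap_seq; apply/seteqP; split => w /=.
    move=> H'; split => i _ /=; rewrite extE.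
      by have [+ _] := H' i; rewrite tnth_mktuple.
    by have [_ +] := H' i; rewrite tnth_mktuple.
  move=> [HA HB] i; rewrite tnth_mktuple/=; split.
    by have := HA i (mem_index_enum _); rewrite /= extE.
  by have := HB i (mem_index_enum _); rewrite /= extE.
congr (_ * _); apply: eq_bigr => i _; rewrite extE.
  exact: (lamE i (mA i)).
exact: (nuE i (mB i)).
Qed.

End sample_law.

(** The tensorized bound is applied to the indicator of E. The maps x0, x1 are measurable
    substitutes for X0, X1, with which they agree at the design points. *)
Lemma sample_change_of_measure {R : realType} d (Omega : measurableType d)
    (P : probability Omega R) (T eps : nat -> {RV P >-> R}) (lam : probability R R)
    (s c : R) (X0 X1 x0 x1 : R -> R) n (E : set (n.-tuple (R * R))) :
  (forall j (A : set R), measurable A -> distribution P (T j) A = lam A) ->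
  (forall j (A : set R), measurable A ->
    distribution P (eps j) A = normal_prob 0 s A) ->
  mutually_independent
    (fun i : nat + nat => match i with inl j => T j | inr j => eps j end) ->
  s != 0 -> measurable_fun setT x0 -> measurable_fun setT x1 ->
  (forall t, (x1 t - x0 t) ^+ 2 / s ^+ 2 <= c) ->
  (forall j w, X0 (T j w) = x0 (T j w)) -> (forall j w, X1 (T j w) = x1 (T j w)) ->
  measurable E ->
  (P (sample T eps X1 n @^-1` E) ^+ 2 <=
   (expR c ^+ n)%:E * P (sample T eps X0 n @^-1` E))%E.
Proof.
move=> lamE epsE indep s0 mx0 mx1 x01 X0E X1E mE.
pose r (x : R -> R) (t : n.-tuple (R * measurableTypeR R)) := [tuple of map (regression_pair x) t].
have mr x : measurable_fun setT x -> measurable_fun setT (r x).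
  by move=> mx; apply: measurable_map_tuple; exact: measurable_regression_pair.
have sE (X x : R -> R) : measurable_fun setT x ->
    (forall j w, X (T j w) = x (T j w)) ->
    P (sample T eps X n @^-1` E) =
    (\int[tuple_prob (lam \x normal_prob 0 s) n]_t (\1_E (r x t))%:E)%E.
  move=> mx XE.
  have -> : sample T eps X n = r x \o @design_noise _ _ _ _ T eps n.
    apply/funext => w; apply: eq_from_tnth => i.
    by rewrite tnth_mktuple /= tnth_map tnth_mktuple /regression_pair/= XE.
  have mrE : measurable (r x @^-1` E) by rewrite -[X in measurable X]setTI; exact: mr.
  rewrite comp_preimage (design_noise_law lamE epsE indep)//.
  by rewrite integral_indic// setIT.
have mI : measurable_fun setT (fun y => (\1_E y : R)%:E).
  by apply/measurable_EFinP; exact: measurable_indic.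
rewrite (sE _ _ mx1 X1E) (sE _ _ mx0 X0E).
have I0 y : (0 <= (\1_E y : R)%:E)%E by rewrite lee_fin.
have := chi2_tensorization (measurable_regression_pair mx0)
  (measurable_regression_pair mx1) (expR_ge0 c)
  (fun f => @regression_chi2 _ lam _ _ _ _ s0 mx0 mx1 x01 f) mI I0.
move=> /le_trans; apply.
apply: lee_wpmul2l; first by rewrite lee_fin exprn_ge0// expR_ge0.
(* An indicator equals its square, so the second moment is again a probability. *)
have sq y : ((\1_E y : R)%:E ^+ 2 = (\1_E y : R)%:E)%E.
  by rewrite expe2 -EFinM indicE; case: (_ \in _); rewrite ?mulr1 ?mulr0.
by under eq_integral do rewrite sq.
Qed.

(** * The oscillating perturbation *)

Section ode.
Context {R : realType}.
Implicit Types (g X phi : R -> R).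

(** Carathéodory's form of the derivative, valid at the end points too: the difference quotient is
    completed at t by its limit. *)
Lemma ode_slope g (x0 : R) X (t : R) : ode_solution g x0 X -> t \in `[0, 1] ->
  exists q, [/\ forall z, X z - X t = q z * (z - t), q t = g (X t) &
    q @ within [set` `[0, 1]] (nbhs t) --> g (X t)].
Proof.
move=> [_ /(_ t) H] /H{}H.
exists (fun z => if z == t then g (X t) else (X z - X t) / (z - t)).
split; last 1 first.
- apply/cvgrPdist_lt => e e0; move/cvgrPdist_lt : H => /(_ e e0).
  rewrite !near_withinE; apply: filterS => z Hz z01.
  by case: eqVneq => [_|zt]; [rewrite subrr normr0|exact: Hz].
- by move=> z; case: eqVneq => [->|zt]; rewrite ?subrr ?mulr0// divfK// subr_eq0.
- by rewrite eqxx.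
Qed.

Lemma ode_solution_continuous g (x0 : R) X : ode_solution g x0 X ->
  {within `[0, 1], continuous X}.
Proof.
move=> gX; apply/subspace_continuousP => t t01.
have [q [qE qt q_cvg]] := ode_slope gX t01.
suff : X t + q z * (z - t) @[z --> within [set` `[0, 1]] (nbhs t)] -->
    X t + g (X t) * (t - t).
  rewrite subrr mulr0 addr0; rewrite (_ : (fun z => _) = X)//.
  by apply/funext => z; rewrite -qE subrKC.
apply: cvgD; first exact: cvg_cst.
apply: cvgM => //; apply: cvgB; last exact: cvg_cst.
exact: cvg_within.
Qed.

Lemma ode_solution_is_derive g (x0 : R) X (t : R) : ode_solution g x0 X ->
  t \in `]0, 1[ -> is_derive t 1 X (g (X t)).
Proof.
move=> gX t01.
have [q [qE qt q_cvg]] := ode_slope gX (subset_itv_oo_cc t01).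
apply/is_derive1_caratheodory; exists q; split => //.
move: q_cvg; rewrite -qt within_interior//.
by rewrite interior_itv.
Qed.

(* phi is the time needed to reach a given position, so it inverts the flow. *)
Lemma ode_solution_inverse g phi (x0 : R) X (t : R) :
  (forall x, g x != 0) -> (forall x : R, is_derive x (1 : R) phi (g x)^-1) -> phi x0 = 0 ->
  ode_solution g x0 X -> t \in `[0, 1] -> phi (X t) = t.
Proof.
move=> g0 dphi phi0 gX; rewrite in_itv/= => /andP[].
have X0 : X 0 = x0 by case: gX.
rewrite le_eqVlt => /predU1P[<- _|t0 t1]; first by rewrite X0.
(* The chain rule gives (g (X s))^-1 * g (X s) = 1; the mean value theorem on [0, t] then
   concludes. *)
have dF s : s \in `]0, t[ -> is_derive s 1 (phi \o X) 1.
  rewrite in_itv/= => /andP[s0 st].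
  have ds : is_derive s 1 X (g (X s)).
    by apply: ode_solution_is_derive gX _; rewrite in_itv/= s0/= (lt_le_trans st).
  by have := is_derive1_comp (dphi (X s)) ds; rewrite mulVf.
have cF : {within `[0, t], continuous (phi \o X)}.
  apply: (@within_continuous_comp _ _ _ `[0, t]%classic X phi).
    move=> x _; apply: differentiable_continuous; apply/derivable1_diffP.
    by case: (dphi x).
  apply: continuous_subspaceW (ode_solution_continuous gX).
  by move=> s /=; rewrite !in_itv/= => /andP[-> /le_trans->].
have [s _] := MVT t0 dF cF.
by rewrite mul1r /= X0 phi0 !subr0.
Qed.

End ode.

Section wave.
Context {R : realType} (m k h : R).
Hypotheses (h0 : 0 < h).

Definition wave_inv x := m^-1 + k * h * cos (x / h).

Definition wave x := (wave_inv x)^-1.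

Definition wave_time x0 x := (x - x0) / m + k * h ^+ 2 * (sin (x / h) - sin (x0 / h)).

Hypothesis wave_inv0 : forall x, wave_inv x != 0.

Let is_derive_div (x : R) : is_derive x (1 : R) (fun y : R => y / h) h^-1.
Proof.
rewrite (_ : (fun y => _) = h^-1 \*: (id : R -> R)); last first.
  by apply/funext => y; rewrite mulrC.
by apply: is_derive_eq; rewrite /GRing.scale/= mulr1.
Qed.

Let is_derive_cosh (x : R) : is_derive x (1 : R) (fun y => cos (y / h)) (- sin (x / h) / h).
Proof. exact: is_derive1_comp. Qed.

Let is_derive_sinh (x : R) : is_derive x (1 : R) (fun y => sin (y / h)) (cos (x / h) / h).
Proof. exact: is_derive1_comp. Qed.

Let is_derive_wave_inv (x : R) : is_derive x (1 : R) wave_inv (- k * sin (x / h)).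
Proof.
rewrite (_ : wave_inv = cst m^-1 + (k * h) \*: (fun y => cos (y / h)))//.
apply: is_derive_eq; rewrite /GRing.scale/= add0r; field.
by rewrite gt_eqF.
Qed.

Lemma is_derive_wave (x : R) :
  is_derive x (1 : R) wave (k * sin (x / h) * wave x ^+ 2).
Proof.
have /= := is_deriveV (wave_inv0 x) (is_derive_wave_inv x).
move/is_derive_eq; apply.
by rewrite /GRing.scale/= /wave exprVn; ring.
Qed.

Lemma is_derive_wave_time (x0 x : R) :
  is_derive x (1 : R) (wave_time x0) (wave x)^-1.
Proof.
rewrite (_ : wave_time x0 = m^-1 \*: (id - cst x0) +
   (k * h ^+ 2) \*: ((fun y => sin (y / h)) - cst (sin (x0 / h)))); last first.
  by apply/funext => y; rewrite /wave_time mulrC.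
apply: is_derive_eq; rewrite /GRing.scale/= !subr0 mulr1 /wave invrK /wave_inv; move: (m^-1) => mi; field.
by rewrite gt_eqF.
Qed.

(* All iterated derivatives of the wave stay in this algebra, so smoothness needs
   no formula for them. *)
Inductive wave_algebra : (R -> R) -> Prop :=
| wave_algebra_cst c : wave_algebra (cst c)
| wave_algebra_sin : wave_algebra (fun x => sin (x / h))
| wave_algebra_cos : wave_algebra (fun x => cos (x / h))
| wave_algebra_wave : wave_algebra wave
| wave_algebraD f g : wave_algebra f -> wave_algebra g -> wave_algebra (f + g)
| wave_algebraM f g : wave_algebra f -> wave_algebra g -> wave_algebra (f * g).

Lemma wave_algebra_is_derive f : wave_algebra f ->
  exists2 df, wave_algebra df & forall x : R, is_derive x (1 : R) f (df x).
Proof.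
elim=> [c||||{}f g fA [df dfA fdf] gA [dg dgA gdg]|{}f g fA [df dfA fdf] gA [dg dgA gdg]].
- by exists (cst 0); [exact: wave_algebra_cst|move=> x; exact: is_derive_cst].
- exists ((fun x => cos (x / h)) * cst h^-1).
    by apply: wave_algebraM; constructor.
  by move=> x; exact: is_derive_sinh.
- exists (cst (- 1) * (fun x => sin (x / h)) * cst h^-1).
    by apply: wave_algebraM; [apply: wave_algebraM|]; constructor.
  by move=> x; apply: is_derive_eq (is_derive_cosh x) _; rewrite !fctE /= mulN1r.
- exists (cst k * (fun x => sin (x / h)) * (wave * wave)).
    by apply: wave_algebraM; apply: wave_algebraM; constructor.
  by move=> x; apply: is_derive_eq (is_derive_wave x) _; rewrite !fctE /= expr2.
- exists (df + dg); first exact: wave_algebraD.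
  by move=> x; exact: is_deriveD.
- exists (f * dg + g * df).
    by apply: wave_algebraD; apply: wave_algebraM.
  by move=> x; exact: is_deriveM.
Qed.

Lemma wave_algebra_derive1n n f : wave_algebra f -> wave_algebra (derive1n n f).
Proof.
move=> fA; elim: n => [//|n /wave_algebra_is_derive[df dfA fdf]].
rewrite derive1nS (_ : (_^`())%classic = df)//; apply/funext => x.
by rewrite derive1E; case: (fdf x).
Qed.

Lemma wave_smooth (D : set R) p : Cn_on D p wave.
Proof.
have H n x : derivable (derive1n n wave) x 1.
  have [df _ /(_ x)[]//] := wave_algebra_is_derive (wave_algebra_derive1n n wave_algebra_wave).
split=> [n _ x _|x _]; first exact: H.
by apply: differentiable_continuous; exact/derivable1_diffP.
Qed.

(** The primitive (u + h sin (u/h) cos (u/h)) / 2 yields at least (b - a)/2 - h, and h <= (b -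
    a)/4. *)
Lemma integral_cos_sqr_ge (a b : R) : a < b -> 4 * h <= b - a ->
  (((b - a) / 4)%:E <= \int[lebesgue_measure]_(u in `[a, b]) (cos (u / h) ^+ 2)%:E)%E.
Proof.
move=> ab hab.
pose F : R -> R := 2^-1 \*: (id + h \*: ((fun u => sin (u / h)) * (fun u => cos (u / h)))).
have dF (x : R) : is_derive x (1 : R) F (cos (x / h) ^+ 2).
  apply: is_derive_eq; rewrite /GRing.scale/=.
  have e := cos2Dsin2 (x / h).
  apply: (@mulfI _ 2) => //.
  transitivity (1 + cos (x / h) ^+ 2 - sin (x / h) ^+ 2).
    by field; rewrite gt_eqF.
  by move: e; lra.
have cF (f : R -> R) df (x : R) : is_derive x (1 : R) f df -> {for x, continuous f}.
  by move=> [dfx _]; apply: differentiable_continuous; exact/derivable1_diffP.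
rewrite (@continuous_FTC2 _ _ F)//.
- rewrite -EFinB lee_fin /F /=.
  have bnd (x : R) : `|sin x * cos x| <= 1.
    rewrite ler_norml; have := cos2Dsin2 x; nra.
  have := bnd (a / h); have := bnd (b / h); rewrite !ler_norml.
  move=> /andP[b1 b2] /andP[a1 a2].
  rewrite !fctE /GRing.scale/=.
  set A := sin (a / h) * cos (a / h) in a1 a2 *.
  set B := sin (b / h) * cos (b / h) in b1 b2 *.
  have hA : h * A <= h by rewrite ler_piMr// ltW.
  have hB : - h <= h * B by rewrite lerNl -mulrN ler_piMr ?(ltW h0)// lerNl.
  by move: hA hB; rewrite -[h *: A]/(h * A) -[h *: B]/(h * B); lra.
- apply: continuous_subspaceT => x.
  rewrite (_ : (fun u => _) = (fun u => cos (u / h)) * (fun u => cos (u / h))).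
    by apply: continuousM; exact: cF (is_derive_cosh x).
  by apply/funext => u; rewrite /= expr2.
- split.
  + by move=> x _; case: (dF x).
  + by apply: cvg_at_right_filter; exact: cF (dF a).
  + by apply: cvg_at_left_filter; exact: cF (dF b).
- by move=> x _; rewrite derive1E; case: (dF x).
Qed.

End wave.

Section wave_bounds.
Context {R : realType} (m k h c0 c1 c2 : R).
Hypotheses (h01 : 0 < h <= 1) (k0 : 0 <= k) (c00 : 0 < c0) (c01 : c0 < c1) (m0 : 0 < m).
Hypotheses (kc1 : k <= m^-1 - c1^-1) (kc0 : k <= c0^-1 - m^-1) (kc2 : k * c1 ^+ 2 <= c2).

Let h0 : 0 < h. Proof. by case/andP: h01. Qed.

Let c10 : 0 < c1. Proof. exact: lt_trans c01. Qed.

(** As h <= 1, the perturbation of 1/m is at most k, which [kc1] and [kc0] allow. *)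
Lemma wave_inv_bounds x : c1^-1 <= wave_inv m k h x <= c0^-1.
Proof.
have : `|k * h * cos (x / h)| <= k.
  rewrite normrM (ger0_norm (mulr_ge0 k0 (ltW h0))) -mulrA ler_piMr// mulr_ile1//.
  - exact: ltW.
  - by case/andP: h01.
  - by rewrite ler_norml cos_geN1 cos_le1.
rewrite ler_norml /wave_inv => /andP[H1 H2].
by apply/andP; split; move: H1 H2 kc1 kc0; lra.
Qed.

Lemma wave_inv_neq0 x : wave_inv m k h x != 0.
Proof.
have /andP[+ _] := wave_inv_bounds x.
by move=> /(lt_le_trans _) H; rewrite gt_eqF// H// invr_gt0.
Qed.

Lemma wave_neq0 x : wave m k h x != 0.
Proof. by rewrite invr_eq0 wave_inv_neq0. Qed.

Lemma wave_bounds x : c0 <= wave m k h x <= c1.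
Proof.
have /andP[H1 H2] := wave_inv_bounds x.
have wi0 : 0 < wave_inv m k h x by rewrite (lt_le_trans _ H1)// invr_gt0.
apply/andP; split.
  by rewrite /wave -(invrK c0) lef_pV2// posrE invr_gt0.
by rewrite /wave -(invrK c1) lef_pV2// posrE invr_gt0.
Qed.

(** The amplitude k h cancels the factor 1/h coming from the frequency, so the derivative is bounded
    by k c1^2 <= c2 whatever h is. *)
Lemma wave_class_G (D : set R) p : class_G D p c0 c1 c2 (wave m k h).
Proof.
split; [by move=> x _; exact: wave_bounds|move=> x _|].
  rewrite derive1E; have [_ ->] := is_derive_wave h0 wave_inv_neq0 x.
  apply: le_trans kc2; have /andP[w0 w1] := wave_bounds x.
  rewrite normrM [`|k * _|]normrM (ger0_norm k0) -mulrA ler_wpM2l// -[leRHS]mul1r ler_pM//.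
    by rewrite ler_norml sin_geN1 sin_le1.
  by rewrite ger0_norm ?sqr_ge0// ler_sqr ?nnegrE ?(ltW c10)// (le_trans (ltW c00)).
exact: (wave_smooth h0 wave_inv_neq0).
Qed.

(** Solving [wave_time] at X t equal to t gives X t = x0 + m t - m k h^2 (sin (X t / h) - sin (x0 /
    h)), and two sines differ by at most 2. *)
Lemma wave_solution_dist X x0 t : ode_solution (wave m k h) x0 X ->
  t \in `[0, 1] -> `|X t - (x0 + m * t)| <= 2 * m * k * h ^+ 2.
Proof.
move=> wX t01.
have wt0 : wave_time m k h x0 x0 = 0 by rewrite /wave_time !subrr mul0r mulr0 addr0.
have := ode_solution_inverse wave_neq0 (is_derive_wave_time m k h0 x0) wt0 wX t01.
rewrite /wave_time => e.
have -> : X t - (x0 + m * t) = - (m * k * h ^+ 2 * (sin (X t / h) - sin (x0 / h))).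
  by rewrite -[in m * t]e; field; rewrite !gt_eqF.
have mkh0 : 0 <= m * k * h ^+ 2.
  by apply: mulr_ge0; [apply: mulr_ge0; [exact: ltW|exact: k0]|exact: sqr_ge0].
rewrite normrN normrM (ger0_norm mkh0).
have -> : 2 * m * k * h ^+ 2 = m * k * h ^+ 2 * 2 by ring.
rewrite ler_wpM2l//.
rewrite ler_norml; have := sin_le1 (X t / h); have := sin_geN1 (X t / h).
by have := sin_le1 (x0 / h); have := sin_geN1 (x0 / h); lra.
Qed.

(** Writing g for the wave, g - m = - m g (1/g - 1/m) = - m g k h cos (u/h) with g >= c0; this
    reduces to the integral of cos^2. *)
Lemma integral_wave_dist_ge (a b : R) : a < b -> 4 * h <= b - a ->
  (((m * c0 * k) ^+ 2 * ((b - a) / 4) * h ^+ 2)%:E <=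
   \int[lebesgue_measure]_(u in `[a, b]) ((wave m k h u - m) ^+ 2)%:E)%E.
Proof.
move=> ab hab.
have H := integral_cos_sqr_ge h0 ab hab.
have -> : (m * c0 * k) ^+ 2 * ((b - a) / 4) * h ^+ 2 =
  (m * c0 * k * h) ^+ 2 * ((b - a) / 4) by ring.
rewrite EFinM; apply: le_trans (lee_wpmul2l _ H) _; first by rewrite lee_fin sqr_ge0.
have cc (f df : R -> R) : (forall x : R, is_derive x (1 : R) f (df x)) -> continuous f.
  move=> dfx x; apply: differentiable_continuous; apply/derivable1_diffP.
  by case: (dfx x).
have mcos : measurable_fun (`[a, b] : set R) (fun u => cos (u / h)).
  apply: measurable_funTS; apply: (@measurableT_comp _ _ _ _ _ _ (@cos R)).
    by apply: continuous_measurable_fun; exact: continuous_cos.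
  exact: measurable_funM.
have mwave : measurable_fun (`[a, b] : set R) (wave m k h).
  apply: measurable_funTS; apply: continuous_measurable_fun.
  by apply: cc => x; exact: (is_derive_wave h0 wave_inv_neq0).
rewrite -ge0_integralZl//; last 3 first.
- by apply/measurable_EFinP; exact: measurable_funX.
- by move=> u _; rewrite lee_fin sqr_ge0.
- by rewrite lee_fin sqr_ge0.
apply: ge0_le_integral => //.
- by move=> u _; rewrite mule_ge0// lee_fin sqr_ge0.
- by apply: measurable_funeM; apply/measurable_EFinP; exact: measurable_funX.
- by apply/measurable_EFinP; apply: measurable_funX; exact: measurable_funB.
move=> u _; rewrite -EFinM lee_fin.
have -> : wave m k h u - m = - (m * k * h * cos (u / h) * wave m k h u).
  have e : k * h * cos (u / h) = (wave m k h u)^-1 - m^-1.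
    by rewrite /wave invrK /wave_inv; ring.
  have -> : m * k * h * cos (u / h) = m * (k * h * cos (u / h)) by ring.
  by rewrite e; field; rewrite wave_neq0 gt_eqF.
have /andP[w0 _] := wave_bounds u.
rewrite sqrrN.
have -> : (m * c0 * k * h) ^+ 2 * cos (u / h) ^+ 2 =
  (m * k * h * cos (u / h)) ^+ 2 * c0 ^+ 2 by ring.
rewrite [leRHS]exprMn ler_wpM2l ?sqr_ge0// ler_sqr ?nnegrE ?(ltW c00)//.
exact: le_trans (ltW c00) w0.
Qed.

End wave_bounds.

(** * Integrated squared error of an estimator *)

Section risk.
Context {R : realType}.
Notation mu := (@lebesgue_measure R).

Definition risk (a b : R) (g f : R -> R) : \bar R :=
  (\int[mu]_(u in `[a, b]) (`|f u - g u| ^+ 2)%:E)%E.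

(* A Lipschitz function is the infimum of the cones over its values at
   countably many points, which makes an estimator jointly measurable. *)
Lemma estimator_joint_measurable (D : set R) (c4 : R) n ghat :
  open D -> D !=set0 -> 0 <= c4 -> estimators D c4 n ghat ->
  exists H : n.-tuple (R * R) * measurableTypeR R -> \bar R,
    measurable_fun setT H /\ forall y u, D u -> H (y, u) = (ghat y u)%:E.
Proof.
move=> oD [d0 Dd0] c40 [Llip mghat].
have lip y u v : D u -> D v -> `|ghat y u - ghat y v| <= c4 * `|u - v|.
  by move=> Du Dv; exact: (Llip y (u, v)).
(* q enumerates the rational points of D, with the default d0 in D at all other indices. *)
pose q k : R := if unpickle k is Some r then
  (if `[< D (ratr r) >] then ratr r else d0) else d0.
have Dq k : D (q k).
  by rewrite /q; case: unpickle => [r|]//; case: asboolP.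
pose H (z : n.-tuple (R * R) * measurableTypeR R) : \bar R :=
  einfs (fun k => (ghat z.1 (q k) + c4 * `|z.2 - q k|)%:E) 0%N.
exists H; split.
  apply: measurable_fun_einfs => k; apply/measurable_EFinP.
  apply: measurable_funD.
    apply: (@measurableT_comp _ _ _ _ _ _ (ghat^~ (q k))); first exact: mghat.
    exact: measurable_fst.
  apply: measurable_funM => //; apply: measurableT_comp => //.
  apply: measurable_funB => //; exact: measurable_snd.
move=> y u Du; rewrite /H /einfs /=; apply/eqP; rewrite eq_le; apply/andP; split.
  apply/lee_addgt0Pr => e e0.
  (* The cone at v exceeds the value at u by at most 2 c4 |u - v|; the extra 1 keeps the divisor
     positive when c4 = 0. *)
  have c1 : 0 < 2 * c4 + 1 by lra.
  have [v [[Dv vu] [r _ rv]]] : (D `&` ball u (e / (2 * c4 + 1))) `&` range ratr !=set0.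
    apply: dense_rat; last by apply: openI => //; exact: ball_open.
    by exists u; split => //; apply: ballxx; rewrite divr_gt0.
  have qr : q (pickle r) = ratr r.
    by rewrite /q pickleK; case: asboolP; rewrite rv.
  apply: (@le_trans _ _ (ghat y (q (pickle r)) + c4 * `|u - q (pickle r)|)%:E).
    by apply: ereal_inf_lbound; exists (pickle r).
  rewrite -EFinD lee_fin qr rv.
  move: vu; rewrite /ball /= => vu.
  have := lip y _ _ Dv Du; rewrite ler_norml distrC => /andP[_].
  have : `|u - v| * (2 * c4 + 1) <= e by rewrite -ler_pdivlMr//; exact: ltW.
  have := normr_ge0 (u - v); nra.
apply/ereal_infP => _ [k _ <-]; rewrite lee_fin.
have := lip y _ _ Du (Dq k); rewrite ler_norml => /andP[_].
by rewrite lerBlDl.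
Qed.

(** Joint measurability in the data and the position lets Tonelli's theorem integrate the position
    out. *)
Lemma measurable_risk (D : set R) (c4 : R) n ghat a b (g : R -> R) :
  open D -> D !=set0 -> 0 <= c4 -> estimators D c4 n ghat ->
  `[a, b] `<=` D -> measurable_fun (`[a, b] : set R) g ->
  measurable_fun setT (fun y => risk a b g (ghat y)).
Proof.
move=> oD D0 c40 eg abD mg.
have [H [mH HE]] := estimator_joint_measurable oD D0 c40 eg.
pose G (z : n.-tuple (R * R) * measurableTypeR R) : \bar R :=
  (\1_(`[a, b]%classic) z.2 * `|fine (H z) - (g \_ `[a, b]) z.2| ^+ 2)%:E.
have mG : measurable_fun setT G.
  apply/measurable_EFinP; apply: measurable_funM.
    by apply: measurableT_comp => //; exact: measurable_snd.
  apply: measurable_funX; apply: measurableT_comp => //.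
  apply: measurable_funB; first exact: measurableT_comp.
  apply: (@measurableT_comp _ _ _ _ _ _ (g \_ `[a, b])); last exact: measurable_snd.
  exact/(measurable_restrictT _ _).1.
have G0 z : (0 <= G z)%E by rewrite lee_fin mulr_ge0.
rewrite (_ : (fun y => _) = fubini_F mu G).
  exact: measurable_fun_fubini_tonelli_F.
apply/funext => y; rewrite /risk /fubini_F [LHS]integral_mkcond.
apply: eq_integral => u _; rewrite /G /= !patchE indicE.
by case: ifPn => uab; rewrite ?mul1r ?mul0r// HE//; apply: abD; rewrite inE in uab.
Qed.

(** The loss is integrated over an interval that depends on the true g, so the comparison takes
    place on an interval [a, b] common to both. *)
Lemma risk_triangle (a b a0 b0 a1 b1 : R) (g0 g1 f : R -> R) :
  a0 <= a -> b <= b0 -> a1 <= a -> b <= b1 ->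
  measurable_fun (`[a0, b0] : set R) f -> measurable_fun (`[a1, b1] : set R) f ->
  measurable_fun setT g0 -> measurable_fun setT g1 ->
  (risk a b g0 g1 <= 2%:E * risk a0 b0 g0 f + 2%:E * risk a1 b1 g1 f)%E.
Proof.
move=> aa0 bb0 aa1 bb1 mf0 mf1 mg0 mg1.
have sub a' b' : a' <= a -> b <= b' -> `[a, b]%classic `<=` `[a', b']%classic.
  move=> aa bb; apply: subset_itv; rewrite bnd_simp//.
have mono a' b' (g : R -> R) : a' <= a -> b <= b' -> measurable_fun (`[a', b'] : set R) f ->
    measurable_fun setT g -> (risk a b g f <= risk a' b' g f)%E.
  move=> aa bb mf mg; apply: ge0_subset_integral => //.
  - apply/measurable_EFinP; apply: measurable_funX; apply: measurableT_comp => //.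
    by apply: measurable_funB => //; exact: measurable_funTS.
  - exact: sub.
apply: (@le_trans _ _ (2%:E * risk a b g0 f + 2%:E * risk a b g1 f)%E); last first.
  by apply: leeD; apply: lee_wpmul2l => //; exact: mono.
have mf : measurable_fun (`[a, b] : set R) f.
  by apply: measurable_funS mf0 => //; exact: sub.
have md (g : R -> R) : measurable_fun setT g ->
    measurable_fun (`[a, b] : set R) (fun u => (`|f u - g u| ^+ 2)%:E).
  move=> mg; apply/measurable_EFinP; apply: measurable_funX; apply: measurableT_comp => //.
  by apply: measurable_funB => //; exact: measurable_funTS.
have p0 (g : R -> R) u : (0 <= (`|f u - g u| ^+ 2)%:E)%E by rewrite lee_fin sqr_ge0.
rewrite /risk -!ge0_integralZl//; [|exact: md|exact: md].
rewrite -ge0_integralD//; last 2 first.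
- by apply: measurable_funeM; exact: md.
- by apply: measurable_funeM; exact: md.
apply: ge0_le_integral => //.
- apply/measurable_EFinP; apply: measurable_funX; apply: measurableT_comp => //.
  by apply: measurable_funB; exact: measurable_funTS.
- by apply: emeasurable_funD; apply: measurable_funeM; exact: md.
move=> u _; rewrite -!EFinM -EFinD lee_fin !real_normK ?num_real//.
(* Parallelogram identity: (v - w)^2 = 2 v^2 + 2 w^2 - (v + w)^2. *)
have := sqr_ge0 (f u - g0 u + (f u - g1 u)).
lra.
Qed.

End risk.

(** * Two-point testing argument *)

Lemma measurable_sample {R : realType} d (Omega : measurableType d)
    (P : probability Omega R) (T eps : nat -> {RV P >-> R}) (X x : R -> R) n :
  measurable_fun setT x -> (forall j w, X (T j w) = x (T j w)) ->
  measurable_fun setT (sample T eps X n).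
Proof.
move=> mx XE; apply/measurable_fun_tnthP => i.
rewrite (_ : _ \o _ = fun w => (T i w, x (T i w) + eps i w)).
  apply: measurable_fun_pair; first exact: measurable_funP.
  by apply: measurable_funD; [apply: measurableT_comp => //|]; exact: measurable_funP.
by apply/funext => w /=; rewrite tnth_mktuple XE.
Qed.

Lemma measurable_estimate {R : realType} (D : set R) (c4 : R) n ghat a b y :
  open D -> D !=set0 -> 0 <= c4 -> estimators D c4 n ghat ->
  `[a, b] `<=` D -> measurable_fun (`[a, b] : set R) (ghat y).
Proof.
move=> oD D0 c40 eg abD.
have [H [mH HE]] := estimator_joint_measurable oD D0 c40 eg.
apply: (eq_measurable_fun (fun u => fine (H (y, u)))).
  by move=> u; rewrite inE => /abD Du; rewrite HE.
by apply: measurable_funTS; apply: measurableT_comp => //; exact: measurableT_comp.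
Qed.

Lemma limn_einf_ge {R : realType} (u : (\bar R)^nat) (b : \bar R) :
  (\forall n \near \oo, b <= u n)%E -> (b <= limn_einf u)%E.
Proof.
move=> [N _ H]; rewrite limn_einf_lim; apply: lime_ge; first exact: is_cvg_einfs.
exists N => // n /= Nn; apply/ereal_infP => _ [j /= nj <-].
by apply: H => /=; exact: leq_trans nj.
Qed.

(** If E1 has probability below 1/(4M) <= 1/4 under S1, its complement has at least 3/4; the change
    of measure then gives E0 at least 9/(16M) under S0. *)
Lemma two_point_bound {R : realType} d d' (Omega : measurableType d) (Y : measurableType d')
    (P : probability Omega R) (S0 S1 : Omega -> Y) (E0 E1 : set Y) (M : R) :
  1 <= M -> measurable_fun setT S0 -> measurable_fun setT S1 ->
  measurable E0 -> measurable E1 -> ~` E1 `<=` E0 ->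
  (P (S1 @^-1` ~` E1) ^+ 2 <= M%:E * P (S0 @^-1` ~` E1))%E ->
  (((4 * M)^-1)%:E <= P (S0 @^-1` E0))%E \/ (((4 * M)^-1)%:E <= P (S1 @^-1` E1))%E.
Proof.
move=> M1 mS0 mS1 mE0 mE1 E10 H.
have pre (S : Omega -> Y) (E : set Y) : measurable_fun setT S -> measurable E -> measurable (S @^-1` E).
  by move=> mS mE; rewrite -[X in measurable X]setTI; exact: mS.
have mC := measurableC mE1.
have P0 : (P (S0 @^-1` ~` E1) <= P (S0 @^-1` E0))%E.
  by apply: le_measure; rewrite ?inE; [exact: pre mS0 mC|exact: pre mS0 mE0|by move=> w; exact: E10].
have PC : P (S1 @^-1` ~` E1) = (1 - P (S1 @^-1` E1))%E.
  by rewrite preimage_setC probability_setC//; exact: pre.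
have f0 := fin_num_measure P _ (pre _ _ mS0 mE0).
have f0' := fin_num_measure P _ (pre _ _ mS0 mC).
have f1 := fin_num_measure P _ (pre _ _ mS1 mE1).
move: P0 H; rewrite PC -(fineK f0) -(fineK f0') -(fineK f1).
set p0 := fine _; set q := fine _; set p1 := fine _.
rewrite -EFinB expe2 -!EFinM !lee_fin => qp0 H.
have M0 : 0 < M by lra.
have b0 : (4 * M)^-1 <= 4^-1 by rewrite lef_pV2 ?posrE ?mulr_gt0//; lra.
have [p1b|p1b] := leP (4 * M)^-1 p1; first by right.
left; rewrite -[leLHS]mul1r ler_pdivrMr ?mulr_gt0//.
nra.
Qed.

(** * Choice of the constants and the minimax lower bound *)

Unset Implicit Arguments.
Set Strict Implicit.

Theorem mainTheorem4 (R : realType) (p : nat)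
    (delta x0 c0 c1 c2 c4 sigma cl cu : R) (D : set R)
    (X : (R -> R) -> R -> R) (fT : R -> R)
    (d : measure_display) (Omega : measurableType d) (P : probability Omega R)
    (T eps : nat -> {RV P >-> R})
    (hp : (3 <= p)%N)
    (hdelta : 0 < delta < 1 / 2)
    (hc01 : 0 < c0 < c1)
    (hc2 : 0 < c2)
    (hc4 : c2 <= c4)
    (hDopen : open D)
    (hDitv : is_interval D)
    (hX : forall g, class_G D p c0 c1 c2 g ->
       ode_solution g x0 (X g) /\ X g @` `[0, 1] `<=` D)
    (hsigma : 0 < sigma)
    (hcl : 0 < cl)
    (hclu : cl <= cu)
    (hfTmeas : measurable_fun (`[0, 1] : set R) fT)
    (hfT : forall t : R, t \in `[0, 1] -> cl <= fT t <= cu)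
    (hT : forall j, has_density01 (T j) fT)
    (heps : forall j (A : set R), measurable A ->
       distribution P (eps j) A = normal_prob 0 sigma A)
    (hindep : mutually_independent
       (fun i : nat + nat => match i with inl j => T j | inr j => eps j end)) :
  exists2 K2 : R, 0 < K2 &
    (0 < limn_einf (fun n : nat =>
       ereal_inf [set
         ereal_sup [set
           P [set w |
              (K2 * n%:R `^ (- ((2 * p)%:R / (2 * p + 3)%:R)))%:E <
              \int[lebesgue_measure]_(u in `[X g delta, X g (1 - delta)%R]%classic)
                 (`|ghat (sample T eps (X g) n w) u - g u| ^+ 2)%:E]
         | g in class_G D p c0 c1 c2]
       | ghat in estimators D c4 n]))%E.
Proof.
have /andP[d0 d12] := hdelta; have /andP[c00 c01] := hc01.
have c10 : 0 < c1 by exact: lt_trans c01.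
pose m := (c0 + c1) / 2.
have c0m : c0 < m by rewrite /m; lra.
have mc1 : m < c1 by rewrite /m; lra.
have m0 : 0 < m by exact: lt_trans c0m.
clearbody m.
(* The first two terms keep the wave within [c0, c1], the third bounds its derivative by c2. *)
pose k := Num.min (Num.min (m^-1 - c1^-1) (c0^-1 - m^-1)) (c2 / c1 ^+ 2).
have k0 : 0 < k.
  by rewrite !lt_min !subr_gt0 !ltf_pV2 ?posrE// mc1 c0m divr_gt0// exprn_gt0.
have kc1 : k <= m^-1 - c1^-1 by rewrite !ge_min lexx.
have kc0 : k <= c0^-1 - m^-1 by rewrite !ge_min lexx orbT.
have kc2 : k * c1 ^+ 2 <= c2.
  by rewrite -ler_pdivlMr ?exprn_gt0// !ge_min lexx !orbT.
clearbody k.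
have z1 : 0 <= m^-1 - c1^-1 by exact: le_trans (ltW k0) kc1.
have z0 : 0 <= c0^-1 - m^-1 by exact: le_trans (ltW k0) kc0.
(* For the constant m, the loss interval has length 2l; [a, a + l] is its middle half, with a margin
   l/2 on each side for the displacement of the other solution. *)
pose l := m * (1 - 2 * delta) / 2.
have l0 : 0 < l by rewrite divr_gt0// mulr_gt0//; lra.
pose a := x0 + m * delta + l / 2.
have ab : a < a + l by rewrite ltrDl.
have b_def : a + l = x0 + m * (1 - delta) - l / 2 by rewrite /a /l; field.
clearbody l.
pose B := (m * c0 * k) ^+ 2 * (l / 4).
have B0 : 0 < B.
  apply: mulr_gt0; last by rewrite divr_gt0.
  by apply: exprn_gt0; rewrite !mulr_gt0.
(* Two losses of at most (B/8) r would put the squared distance of g0 and g1 at no more than B r /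
   2, below its lower bound B h^2. *)
exists (B / 8); first by rewrite divr_gt0.
(* Each observation costs (2 m k h^2 / sigma)^2 = C h^4 = C/n in the exponent, hence exp C for n of
   them. *)
pose C := (2 * m * k / sigma) ^+ 2.
have C0 : 0 <= C by exact: sqr_ge0.
pose M := expR C.
have M1 : 1 <= M by rewrite -expR0 ler_expR.
apply: (@lt_le_trans _ _ (((4 * M)^-1)%:E)).
  by rewrite lte_fin invr_gt0 mulr_gt0// (lt_le_trans _ M1).
pose hn (n : nat) : R := Num.sqrt (Num.sqrt n%:R^-1).
have small e : 0 < e -> \forall n \near \oo, hn n <= e.
  move=> e0; near=> n.
  have n0 : 0 < n%:R :> R by rewrite ltr0n; near: n; exists 1%N.
  rewrite -(ger0_norm (ltW e0)) -sqrtr_sqr ler_sqrt ?sqr_ge0//.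
  rewrite -(ger0_norm (sqr_ge0 e)) -sqrtr_sqr ler_sqrt ?sqr_ge0//.
  rewrite invf_ple ?posrE// ?exprn_gt0//.
  by near: n; exact: nbhs_infty_ger.
apply: limn_einf_ge; near=> n.
have n0 : 0 < n%:R :> R by rewrite ltr0n; near: n; exists 1%N.
have h1 : hn n <= 1 by near: n; exact: small.
have hl4 : hn n <= l / 4 by near: n; apply: small; rewrite divr_gt0.
have hlk : hn n <= l / 2 / (2 * m * k).
  by near: n; apply: small; rewrite !divr_gt0// !mulr_gt0.
pose h := hn n; rewrite -/h in h1 hl4 hlk.
have h0 : 0 < h by rewrite !sqrtr_gt0 invr_gt0.
have hl : 4 * h <= l by rewrite mulrC -ler_pdivlMr.
have hk : 2 * m * k * h ^+ 2 <= l / 2.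
  move: hlk; rewrite ler_pdivlMr ?mulr_gt0//; apply: le_trans.
  rewrite mulrC ler_wpM2r//; first by rewrite !mulr_ge0// ltW.
  by rewrite expr2 ler_piMl// ltW.
have h2 : h ^+ 2 = Num.sqrt n%:R^-1 by rewrite sqr_sqrtr ?sqrtr_ge0.
have h4 : h ^+ 2 ^+ 2 = n%:R^-1 by rewrite h2 sqr_sqrtr// invr_ge0 ltW.
(* The comparison with h^2 = n^(-1/2) amounts to 1/2 <= 2p / (2p + 3), that is 3 <= 2p. *)
pose r := n%:R `^ (- ((2 * p)%:R / (2 * p + 3)%:R)) : R.
have r_le : r <= h ^+ 2.
  rewrite h2 sqrtrV ?ler0n// -powR12_sqrt ?ler0n// -powRN ler_powR//.
    by rewrite ler1n -(ltr0n R).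
  rewrite lerN2 ler_pdivlMr ?ltr0n ?addn_gt0 ?orbT// ler_pdivrMl// -natrM ler_nat.
  by rewrite [leqRHS]mul2n -addnn leq_add2l (leq_trans hp)// leq_pmull.
apply/ereal_infP => _ [ghat eghat <-].
(* The constant m is the wave of amplitude 0, so the lemmas on waves cover both hypotheses; the
   distance bound 0 gives its solution exactly. *)
pose g0 := wave m 0 1; pose g1 := wave m k h.
have g0E u : g0 u = m by rewrite /g0 /wave /wave_inv !mul0r addr0 invrK.
have h01 : 0 < h <= 1 by rewrite h0 h1.
have one01 : 0 < (1 : R) <= 1 by rewrite ltr01 lexx.
have z2 : 0 * c1 ^+ 2 <= c2 by rewrite mul0r ltW.
have G0 : class_G D p c0 c1 c2 g0 by exact: wave_class_G.
have G1 : class_G D p c0 c1 c2 g1 by apply: wave_class_G => //; exact: ltW.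
have [s0 _] := hX _ G0; have [s1 _] := hX _ G1.
have dist0 t : t \in `[0, 1] -> X g0 t = x0 + m * t.
  move=> t01; apply/eqP; rewrite -subr_eq0 -normr_le0.
  have := wave_solution_dist one01 (lexx 0) c00 c01 m0 z1 z0 s0 t01.
  by rewrite mulr0 mul0r.
have dist1 t : t \in `[0, 1] -> `|X g1 t - (x0 + m * t)| <= 2 * m * k * h ^+ 2.
  exact: (wave_solution_dist h01 (ltW k0) c00 c01 m0 kc1 kc0 s1).
have in01 g t : class_G D p c0 c1 c2 g -> t \in `[0, 1] -> D (X g t).
  by move=> Gg t01; have [_] := hX _ Gg; apply; exists t.
have dl01 : delta \in `[0, 1] by rewrite in_itv/=; apply/andP; split; lra.
have dr01 : 1 - delta \in `[0, 1] by rewrite in_itv/=; apply/andP; split; lra.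
have itvD g : class_G D p c0 c1 c2 g -> `[X g delta, X g (1 - delta)] `<=` D.
  move=> Gg u /=; rewrite in_itv/= => uI.
  exact: (hDitv _ _ (in01 _ _ Gg dl01) (in01 _ _ Gg dr01)).
have Dn0 : D !=set0 by exists (X g0 delta); exact: in01.
have c40 : 0 <= c4 by exact: le_trans (ltW hc2) hc4.
pose F g y := risk (X g delta) (X g (1 - delta)) g (ghat y).
pose E g := [set y | ((B / 8 * r)%:E < F g y)%E].
have mg f (df : R -> R) : (forall x : R, is_derive x (1 : R) f (df x)) -> measurable_fun setT f.
  move=> dfx; apply: continuous_measurable_fun => x.
  by apply: differentiable_continuous; apply/derivable1_diffP; case: (dfx x).
have mg0 : measurable_fun setT g0.
  by rewrite (_ : g0 = cst m)//; apply/funext => u; rewrite g0E.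
have mg1 : measurable_fun setT g1.
  apply: mg => x; apply: is_derive_wave => // u.
  exact: (wave_inv_neq0 h01 (ltW k0) c00 c01 kc1 kc0).
have mE g : class_G D p c0 c1 c2 g -> measurable_fun setT g -> measurable (E g).
  move=> Gg mgg; rewrite -[E g]setTI; apply: measurable_lte => //.
  exact: (measurable_risk hDopen Dn0 c40 eghat (itvD _ Gg) (measurable_funTS mgg)).
(* No estimate is close to both g0 and g1: their distance on the common core [a, a + l] is too
   large. *)
have sep : ~` E g1 `<=` E g0.
  move=> y /negP; rewrite -leNgt => F1; rewrite /E /= ltNge; apply/negP => F0.
  have : (risk a (a + l) g0 g1 <= 2%:E * F g0 y + 2%:E * F g1 y)%E.
    apply: risk_triangle => //.
    - by rewrite dist0// /a; lra.
    - by rewrite dist0// b_def; lra.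
    - have := dist1 _ dl01; rewrite ler_norml => /andP[_]; rewrite /a; lra.
    - have := dist1 _ dr01; rewrite ler_norml b_def => /andP[+ _]; lra.
    - exact: (measurable_estimate y hDopen Dn0 c40 eghat) (itvD _ G0).
    - exact: (measurable_estimate y hDopen Dn0 c40 eghat) (itvD _ G1).
  apply/negP; rewrite -ltNge.
  apply: (@le_lt_trans _ _ (2%:E * (B / 8 * r)%:E + 2%:E * (B / 8 * r)%:E)%E).
    by apply: leeD; exact: lee_wpmul2l.
  apply: (@lt_le_trans _ _ ((B * h ^+ 2)%:E)).
    rewrite -!EFinM -EFinD lte_fin.
    have : B * r <= B * h ^+ 2 by rewrite ler_pM2l.
    have : 0 < B * h ^+ 2 by rewrite mulr_gt0// exprn_gt0.
    lra.
  have -> : risk a (a + l) g0 g1 =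
      (\int[lebesgue_measure]_(u in `[a, (a + l)%R]) ((g1 u - m) ^+ 2)%:E)%E.
    by apply: eq_integral => u _; rewrite g0E real_normK// num_real.
  have := integral_wave_dist_ge h01 (ltW k0) c00 c01 m0 kc1 kc0 ab.
  by rewrite [a + l - a]addrAC subrr add0r => /(_ hl).
(* X g is controlled on [0, 1] only; its extension by 0 is measurable and agrees with it at the
   design points. *)
have mX g : class_G D p c0 c1 c2 g -> measurable_fun setT (X g \_ `[0, 1]).
  move=> Gg; apply/(measurable_restrictT _ _).1 => //.
  apply: subspace_continuous_measurable_fun => //.
  by have [/ode_solution_continuous] := hX _ Gg.
have XE g j w : X g (T j w) = (X g \_ `[0, 1]) (T j w).
  by rewrite patchE mem_set//; case: (hT j) => + _; apply.
pose x g := X g \_ `[0, 1].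
pose c := C / n%:R.
have x01 t : (x g1 t - x g0 t) ^+ 2 / sigma ^+ 2 <= c.
  have [t01|t01] := boolP (t \in `[0, 1]); last first.
    rewrite /x !patchE memNset; last by apply/negP.
    by rewrite subrr expr0n/= mul0r divr_ge0.
  rewrite /x !patchE mem_set// dist0//.
  have -> : c = (2 * m * k * h ^+ 2) ^+ 2 / sigma ^+ 2.
    by rewrite /c /C -h4; field; rewrite gt_eqF.
  rewrite ler_pM2r ?invr_gt0 ?exprn_gt0//.
  rewrite -[leLHS]real_normK ?num_real// ler_sqr ?nnegrE ?dist1//.
  exact: le_trans (normr_ge0 _) (dist1 _ t01).
(* The common density makes the law of [T 0] serve for every design point. *)
have lamE j (A : set R) : measurable A -> distribution P (T j) A = distribution P (T 0%N) A.
  by move=> mA; case: (hT j) => _ ->//; case: (hT 0%N) => _ ->.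
have change := sample_change_of_measure lamE heps hindep (lt0r_neq0 hsigma)
  (mX _ G0) (mX _ G1) x01 (XE g0) (XE g1) (measurableC (mE _ G1 mg1)).
have expM : expR c ^+ n = M.
  by rewrite -expRM_natl /c mulrC divfK// gt_eqF.
rewrite expM in change.
have sup g : class_G D p c0 c1 c2 g -> (((4 * M)^-1)%:E <= P (sample T eps (X g) n @^-1` E g))%E ->
  (((4 * M)^-1)%:E <= ereal_sup [set P (sample T eps (X g) n @^-1` E g) | g in class_G D p c0 c1 c2])%E.
  by move=> Gg /le_trans; apply; apply: ereal_sup_ubound; exists g.
have [H|H] := two_point_bound M1 (@measurable_sample _ _ _ P T eps _ _ n (mX _ G0) (XE g0))
  (@measurable_sample _ _ _ P T eps _ _ n (mX _ G1) (XE g1)) (mE _ G0 mg0) (mE _ G1 mg1) sep change.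
  exact: sup G0 H.
exact: sup G1 H.
Unshelve. all: by end_near.
Qed.
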